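(* Let $\mathcal R_{\mathbb K}[H]$ be the Hibi ring over a field $\mathbb K$ on a finite distributive lattice $H$. Then $\mathcal R_{\mathbb K}[H]$ is level (resp. anticanonical level) if and only if the only $q^{(1)}$-reduced (resp. $q^{(-1)}$-reduced) sequence with condition N is the empty sequence.
   Context: **Hibi rings.** Let $x_0$ be the least element of $H$ and $P=\{\alpha\in H: \alpha=\beta\vee\gamma\Rightarrow\alpha=\beta\text{ or }\alpha=\gamma\}$ the poset of join-irreducible elements (so $x_0\in P$). With indeterminates $\{T_x\}_{x\in P}$, $\mathcal R_{\mathbb K}[H]=\mathbb K[\prod_{x\in I}T_x: I\text{ a nonempty down-closed subset of }P]$, graded by $\deg T_{x_0}=1$, $\deg T_x=0$ for $x\ne x_0$; it is a standard graded normal Cohen-Macaulay domain. Let $P^+=P\cup\{\infty\}$ with $x<\infty$ for all $x\in P$; $x\lessdot y$ means $y$ covers $x$. The canonical ideal (a graded canonical module) is $\omega=\bigoplus_\nu\mathbb K\prod_{x\in P}T_x^{\nu(x)}$, over all $\nu:P^+\to\mathbb Z$ with $\nu(\infty)=0$ and $\nu(x)-\nu(y)\ge1$ if $x\lessdot y$ in $P^+$; $\omega^{(-1)}=R:_{Q(R)}\omega$ ($R=\mathcal R_{\mathbb K}[H]$) is its inverse in the group of divisorial fractional ideals. **Level.** The ring is level if all minimal homogeneous generators of $\omega$ have the same degree, and anticanonical level if all minimal homogeneous generators of $\omega^{(-1)}$ have the same degree. **Quasi-distance.** For $x\le y$ in $P^+$ and $n\in\mathbb Z$, $q^{(n)}\mathrm{dist}(x,y)=\max\{nt\mid\text{there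 is a saturated chain }x=z_0\lessdot z_1\lessdot\cdots\lessdot z_t=y\}$. For $w_0<z_0>w_1<z_1>\cdots>w_\ell<z_\ell$ in $P^+$, $q^{(n)}(w_0,z_0,\ldots,w_\ell,z_\ell)=\sum_{i=0}^\ell q^{(n)}\mathrm{dist}(w_i,z_i)-\sum_{i=1}^\ell q^{(n)}\mathrm{dist}(w_i,z_{i-1})$. **Condition N and reducedness.** A (possibly empty, $t=0$) sequence $y_0,x_1,y_1,x_2,\ldots,y_{t-1},x_t$ of elements of $P\setminus\{x_0\}$ satisfies condition N if $y_0>x_1<y_1>x_2<\cdots<y_{t-1}>x_t$ and $y_i\not\ge x_j$ whenever $i\le j-2$. One always puts $x_0$ in front and sets $y_t=\infty$. It is $q^{(n)}$-reduced if $q^{(n)}\mathrm{dist}(x_i,y_j)<q^{(n)}(x_i,y_i,\ldots,x_j,y_j)$ for all $0\le i<j\le t$ with $x_i\le y_j$; the empty sequence is $q^{(n)}$-reduced. *)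

(* Defs.v *)
From HB Require Import structures.
From mathcomp Require Import all_boot all_order all_algebra.
From mathcomp Require Import mpoly.
Set Implicit Arguments.
Unset Strict Implicit.
Unset Printing Implicit Defensive.
Import Order.TTheory GRing.Theory Num.Theory.
Local Open Scope ring_scope.

Definition covers (disp : Order.disp_t) (T : finPOrderType disp) (x y : T) : bool :=
  (x < y)%O && ~~ [exists z : T, (x < z)%O && (z < y)%O].

(* The least element satisfies this condition, and is kept in the poset. *)
Definition join_irreducible (disp : Order.disp_t)
    (H : finTBDistrLatticeType disp) (a : H) : bool :=
  [forall b : H, forall c : H,
     (a == Order.join b c) ==> (a == b) || (a == c)].

Section Posets.
Variables (disp : Order.disp_t) (H : finTBDistrLatticeType disp).

Definition jirr : predArgType := {a : H | join_irreducible a}.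
HB.instance Definition _ := [isSub of jirr for @sval H (@join_irreducible disp H)].
HB.instance Definition _ := [Finite of jirr by <:].
HB.instance Definition _ := [SubChoice_isSubPOrder of jirr by <: with disp].

Lemma bottom_join_irreducible : join_irreducible (Order.bottom : H).
Proof.
apply/forallP => b; apply/forallP => c; apply/implyP => /eqP /esym/eqP.
by rewrite join_eq0 => /andP[/eqP-> _]; rewrite eqxx.
Qed.

Definition x0 : jirr := exist _ Order.bottom bottom_join_irreducible.

(* P^+ : the poset P with a new greatest element None = oo. *)
Definition jirr_plus : predArgType := option jirr.
HB.instance Definition _ := Finite.on jirr_plus.

Definition infty : jirr_plus := None.

Definition le_plus (a b : jirr_plus) : bool :=
  match a, b with
  | _, None => true
  | None, Some _ => false
  | Some x, Some y => (x <= y)%O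
  end.

Lemma le_plus_refl : reflexive le_plus.
Proof. by case=> /=. Qed.

Lemma le_plus_anti : antisymmetric le_plus.
Proof. by case=> [x|] [y|] //= /le_anti->. Qed.

Lemma le_plus_trans : transitive le_plus.
Proof. by case=> [y|] [x|] [z|] //=; apply: le_trans. Qed.

HB.instance Definition _ :=
  Order.Le_isPOrder.Build disp jirr_plus le_plus_refl le_plus_anti le_plus_trans.

(* A saturated chain x = z_0 <. z_1 <. ... <. z_t = y; the tuple is (z_1, ..., z_t). *)
Definition has_saturated_chain (x y : jirr_plus) (t : nat) : bool :=
  [exists z : t.-tuple jirr_plus,
     path (@covers disp jirr_plus) x z && (last x z == y)].

(* The z_i of a saturated chain are distinct, so t < #|P^+|. *)
Definition saturated_lengths (x y : jirr_plus) : seq nat :=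
  [seq t <- iota 0 #|jirr_plus| | has_saturated_chain x y t].

Definition max_int (s : seq int) : int := foldr Num.max (head 0 s) s.

(* Meaningful only for x <= y, when the list of lengths is nonempty. *)
Definition qdist (n : int) (x y : jirr_plus) : int :=
  max_int [seq n * t%:Z | t <- saturated_lengths x y].

(* q^(n)(w_i, z_i, ..., w_j, z_j) *)
Definition qsum (n : int) (w z : nat -> jirr_plus) (i j : nat) : int :=
  \sum_(i <= k < j.+1) qdist n (w k) (z k)
  - \sum_(i.+1 <= k < j.+1) qdist n (w k) (z k.-1).

(* y_0, x_1, y_1, x_2, ..., y_(t-1), x_t is encoded by the list of pairs
   [:: (y_0, x_1); ...; (y_(t-1), x_t)], of size t.  With x_0 put in front and
   y_t = oo, [xs s i] is x_i and [ys s i] is y_i for i <= t. *)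
Definition xs (s : seq (jirr * jirr)) (i : nat) : jirr_plus :=
  Some (nth x0 (x0 :: unzip2 s) i).

Definition ys (s : seq (jirr * jirr)) (i : nat) : jirr_plus :=
  nth infty [seq Some y | y <- unzip1 s] i.

Definition condition_N (s : seq (jirr * jirr)) : Prop :=
  [/\ forall p, p \in s -> p.1 != x0 /\ p.2 != x0,
      forall i, (i < size s)%N -> (xs s i.+1 < ys s i)%O,
      forall i, (0 < i < size s)%N -> (xs s i < ys s i)%O
    & forall i j, (i.+2 <= j <= size s)%N -> ~~ (xs s j <= ys s i)%O].

Definition q_reduced (n : int) (s : seq (jirr * jirr)) : Prop :=
  forall i j, (i < j <= size s)%N -> (xs s i <= ys s j)%O ->
    qdist n (xs s i) (ys s j) < qsum n (xs s) (ys s) i j.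

End Posets.

Section HibiRing.
Variables (K : fieldType) (disp : Order.disp_t) (H : finTBDistrLatticeType disp).

Local Notation P := (jirr H).
Local Notation Pplus := (jirr_plus H).

(* K(T_x : x in P), in which the Hibi ring, its field of fractions and the
   fractional ideals are all realized as subsets. *)
Definition ratfun : fieldType := {fraction {mpoly K[#|P|]}}.

Definition const (c : K) : ratfun := tofrac c%:MP_[#|P|].

Definition indet (x : P) : ratfun := tofrac ('X_(enum_rank x) : {mpoly K[#|P|]}).

Definition monom (nu : P -> int) : ratfun := \prod_(x : P) indet x ^ nu x.

Definition down_closed (I : {set P}) : Prop :=
  forall x y : P, x \in I -> (y <= x)%O -> y \in I.

(* The K-subalgebra generated by the products of the T_x over the nonempty
   down-closed sets. *)
Inductive hibi : ratfun -> Prop :=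
| hibi_const c : hibi (const c)
| hibi_gen (I : {set P}) :
    I != set0 -> down_closed I -> hibi (\prod_(x in I) indet x)
| hibi_add f g : hibi f -> hibi g -> hibi (f + g)
| hibi_mul f g : hibi f -> hibi g -> hibi (f * g).

Definition hibi_frac (f : ratfun) : Prop :=
  exists a b, [/\ hibi a, hibi b, b != 0 & f = a / b].

(* The A-submodule generated by S, for a subring A. *)
Inductive lin_span (A S : ratfun -> Prop) : ratfun -> Prop :=
| lin_span_zero : lin_span A S 0
| lin_span_add a s f : A a -> S s -> lin_span A S f -> lin_span A S (a * s + f).

Definition scalars (f : ratfun) : Prop := exists c, f = const c.

(* Homogeneous of degree d in the Laurent polynomial ring K[T_x, T_x^-1],
   with deg T_(x_0) = 1 and deg T_x = 0 otherwise.  This ring contains the Hibi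
   ring, omega and omega^(-1), whose gradings are all induced by it. *)
Definition homogeneous (d : int) : ratfun -> Prop :=
  lin_span scalars (fun f => exists nu : P -> int, nu (x0 H) = d /\ f = monom nu).

Definition omega : ratfun -> Prop :=
  lin_span scalars (fun f => exists nu : Pplus -> int,
    [/\ nu (infty H) = 0,
        forall x y : Pplus, covers x y -> 1 <= nu x - nu y
      & f = monom (fun x => nu (Some x))]).

Definition omega_inv (f : ratfun) : Prop :=
  hibi_frac f /\ forall g, omega g -> hibi (f * g).

Definition generates (S M : ratfun -> Prop) : Prop :=
  forall f, M f <-> lin_span hibi S f.

Definition minimal_homogeneous_system (M S : ratfun -> Prop) : Prop :=
  [/\ forall f, S f -> exists d, homogeneous d f,
      generates S M
    & forall S' : ratfun -> Prop, (forall f, S' f -> S f) ->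
        generates S' M -> forall f, S f -> S' f].

Definition minimal_homogeneous_generator (M : ratfun -> Prop) (f : ratfun) : Prop :=
  exists S, minimal_homogeneous_system M S /\ S f.

Definition generated_in_same_degree (M : ratfun -> Prop) : Prop :=
  forall f g d e,
    minimal_homogeneous_generator M f -> minimal_homogeneous_generator M g ->
    homogeneous d f -> homogeneous e g -> d = e.

Definition level : Prop := generated_in_same_degree omega.

Definition anticanonical_level : Prop := generated_in_same_degree omega_inv.

End HibiRing.

(* Main.v *)
Require Import Defs.
From HB Require Import structures.
From mathcomp Require Import all_boot all_order all_algebra zify mpoly.
From Stdlib Require Import Classical.
Set Implicit Arguments.
Unset Strict Implicit.
Unset Printing Implicit Defensive.
Import Order.TTheory GRing.Theory Num.Theory.
Local Open Scope ring_scope.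

(**
The Hibi ring R, omega and omega^(-1) are all spanned over K by Laurent monomials
T^nu, where nu runs over T(0), T(1) and T(-1) respectively.  Here T(n) is the set of
the integer functions nu on P^+ that vanish at oo and satisfy nu(x) - nu(y) >= n
whenever y covers x.  For R this holds because a decreasing nonnegative function is
the sum of the indicators of its superlevel sets ([hibi_monom]).  For omega^(-1) it holds
because every cover x <. y is tight for some exponent of omega
([cover_tight_exponent], [omega_invE]).  So both equivalences are instances, for
n = 1 and n = -1, of one statement on the span of T(n), proved for every integer n.

Since the degrees of R are nonnegative and its degree 0 part is K, the degrees of the
minimal homogeneous generators of the span of T(n) are the degrees nu(x_0) of the
minimal exponents, those nu that leave T(n) when a nonzero element of T(0) is
subtracted ([same_degree_minimal]).  The smallest degree is q^(n)dist(x_0, oo), and it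
is attained, so the question is whether some minimal nu has nu(x_0) different from
q^(n)dist(x_0, oo).

An element of T(0) that can be subtracted from nu dominates the indicator of a
nonempty down-closed set I with nu(x) - nu(y) > n on each cover that leaves I.  The
smallest candidate I is obtained from x_0 by going down freely and going up along
tight covers, those with nu(x) - nu(y) = n.  So nu is minimal exactly when oo is
reached in this way ([minimal_exponent_forced]).

A route from x_0 to oo that alternates tight ascents x_i -> y_i with descents
y_i -> x_(i+1) is the shape of a sequence in condition N.  If the number of descents
is as small as possible, no shortcut exists, and this gives at once condition N and
q^(n)-reducedness: nu(x_i) - nu(y_j) lies between q^(n)dist(x_i, y_j) and
q^(n)(x_i, y_i, ..., x_j, y_j), and equality of these two bounds would make
x_i -> y_j a tight shortcut ([shortest_condition_N], [shortest_q_reduced]).  The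
sequence is empty only if nu(x_0) = q^(n)dist(x_0, oo).

Conversely, given a reduced sequence, prescribe nu on it so that all ascents and all
descents are tight, and take the smallest nu in T(n) that is at least as large at the
y_i ([zigzag_potential]).  Reducedness and condition N make the prescribed values
compatible ([qdist_val_le]), so nu takes them.  This nu is minimal, and if the sequence
is not empty then nu(x_0) = q^(n)(x_0, y_0, ..., x_t, oo) > q^(n)dist(x_0, oo).
*)

(** * Saturated chains and quasi-distance *)

Section QuasiDistance.
Variables (disp : Order.disp_t) (H : finTBDistrLatticeType disp).
Local Notation P := (jirr H).
Local Notation Pplus := (jirr_plus H).
Implicit Types (x y z : Pplus) (n : int) (nu : Pplus -> int).

Lemma saturated_chainP x y t :
  reflect (exists s, [/\ size s = t, path (@covers disp Pplus) x s & last x s = y])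
          (has_saturated_chain x y t).
Proof.
apply: (iffP existsP) => [[s /andP[sP /eqP sy]]|[s [<- sP sy]]].
  by exists s; rewrite size_tuple.
by exists (in_tuple s); rewrite sP sy eqxx.
Qed.

Lemma covers_lt x y : covers x y -> (x < y)%O.
Proof. by case/andP. Qed.

Lemma saturated_chain_le x y t : has_saturated_chain x y t -> (x <= y)%O.
Proof.
case/saturated_chainP => s [_ + <-].
elim: s x => //= z s IHs x /andP[/covers_lt/ltW xz /IHs].
exact: le_trans.
Qed.

Lemma saturated_chain_size x y t :
  has_saturated_chain x y t -> (t < #|Pplus|)%N.
Proof.
case/saturated_chainP => s [<- sP _].
have ltP : path (fun u v => (u < v)%O) x s by apply: sub_path sP => u v /covers_lt.
have /card_uniqP us : uniq (x :: s) by apply: (sorted_uniq lt_trans ltxx).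
by rewrite -[(size s).+1]us max_card.
Qed.

Lemma saturated_chain_cat x y z t u :
  has_saturated_chain x y t -> has_saturated_chain y z u ->
  has_saturated_chain x z (t + u).
Proof.
case/saturated_chainP => s [<- sP <-] /saturated_chainP[r [<- rP <-]].
by apply/saturated_chainP; exists (s ++ r); rewrite size_cat cat_path sP last_cat.
Qed.

Lemma saturated_chain0 x : has_saturated_chain x x 0.
Proof. by apply/saturated_chainP; exists [::]. Qed.

Lemma covers_saturated_chain x y : covers x y -> has_saturated_chain x y 1.
Proof. by move=> xy; apply/saturated_chainP; exists [:: y]; rewrite /= xy. Qed.

(** Among the elements above [x] and up to [y], one with the fewest elements below it
    covers [x]; replacing [x] by it shrinks the interval. *)
Lemma saturated_chain_exists x y :
  (x <= y)%O -> exists t, has_saturated_chain x y t.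
Proof.
have [m] := ubnP #|[set z | (x < z <= y)%O]|.
elim: m x => // m IHm x; rewrite ltnS => le_m.
rewrite le_eqVlt => /predU1P[->|xy]; first by exists 0%N; apply: saturated_chain0.
have [z] : exists z, covers x z && (z <= y)%O.
  have [/negP xNy|/negPn/existsP[u /andP[xu uy]]] :=
    boolP (~~ [exists u : Pplus, (x < u)%O && (u < y)%O]).
    by exists y; rewrite /covers xy lexx andbT; apply/negP.
  pose A := [pred v | (x < v <= y)%O].
  have Ay : A y by rewrite /= xy lexx.
  case: (@arg_minnP _ y A (fun v => #|[set w | (w < v)%O]|) Ay) => v /andP[xv vy] vmin.
  exists v; rewrite vy andbT /covers xv; apply/existsP => -[w /andP[xw wv]].
  have := vmin w; rewrite /A /= xw (le_trans (ltW wv) vy) => /(_ isT).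
  rewrite leqNgt => /negP; apply; apply: proper_card; apply/properP; split.
    by apply/subsetP => a; rewrite !inE => aw; apply: lt_trans wv.
  by exists w; rewrite inE ?ltxx.
case/andP=> xz zy; have [|t zt] := IHm z _ zy.
  apply: leq_trans le_m; apply: proper_card; apply/properP; split.
    apply/subsetP => a; rewrite !inE => /andP[za ->]; rewrite andbT.
    by apply: lt_trans za; apply: covers_lt.
  by exists z; rewrite inE ?ltxx // zy covers_lt.
by exists (1 + t)%N; apply: saturated_chain_cat zt; apply: covers_saturated_chain.
Qed.

Lemma max_intP (s : seq int) :
  s != [::] -> max_int s \in s /\ forall a, a \in s -> a <= max_int s.
Proof.
case: s => // a s _; rewrite /max_int /=.
have: foldr Num.max a s \in a :: s /\ forall b, b \in a :: s -> b <= foldr Num.max a s.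
  elim: s => [|b s [IH1 IH2]] /=.
    by split=> [|b]; rewrite !inE // => /eqP->.
  split.
    move: IH1; rewrite !inE; case: leP => _; rewrite ?eqxx ?orbT //.
    by case/orP=> ->; rewrite ?orbT.
  move=> c; rewrite !inE le_max => /or3P[/eqP->|/eqP->|cs].
  - by rewrite IH2 ?orbT ?inE ?eqxx.
  - by rewrite lexx.
  - by rewrite IH2 ?orbT ?inE ?cs ?orbT.
move=> [m1 m2]; have /max_idPr-> := m2 a (mem_head _ _); by split.
Qed.

Lemma saturated_chain_qdist n x y t :
  has_saturated_chain x y t -> n * t%:Z <= qdist n x y.
Proof.
move=> c; have tl : t \in saturated_lengths x y.
  by rewrite mem_filter c mem_iota (saturated_chain_size c).
have nt : n * t%:Z \in [seq n * t%:Z | t <- saturated_lengths x y].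
  exact: (map_f (fun t : nat => n * t%:Z)).
by apply: (proj2 (max_intP _)) => //; case: (map _ _) nt.
Qed.

Lemma qdist_attained n x y :
  (x <= y)%O -> exists2 t, has_saturated_chain x y t & qdist n x y = n * t%:Z.
Proof.
move=> /saturated_chain_exists[u c].
have : max_int [seq n * t%:Z | t <- saturated_lengths x y]
         \in [seq n * t%:Z | t <- saturated_lengths x y].
  apply: (proj1 (max_intP _)); rewrite -size_eq0 size_map size_eq0 -has_filter.
  apply/hasP; exists u => //.
  by rewrite mem_iota (saturated_chain_size c).
by case/mapP => t; rewrite mem_filter => /andP[tc _]; exists t.
Qed.

Lemma qdistxx n x : qdist n x x = 0.
Proof.
have [t c ->] := qdist_attained n (lexx x).
case/saturated_chainP: c => -[|z s] [<- //=]; first by rewrite mulr0.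
case/andP=> /covers_lt xz sP szx.
suff : (z <= x)%O by move=> /(lt_le_trans xz); rewrite ltxx.
rewrite -szx; apply: (saturated_chain_le (t := size s)).
by apply/saturated_chainP; exists s.
Qed.

(** The concatenation of two extremal saturated chains is one of the chains that compete
    for [qdist n x z]. *)
Lemma qdist_superadd n x y z : (x <= y)%O -> (y <= z)%O ->
  qdist n x y + qdist n y z <= qdist n x z.
Proof.
move=> /(qdist_attained n)[t ct ->] /(qdist_attained n)[u cu ->].
by rewrite -mulrDr -PoszD; apply/saturated_chain_qdist/(saturated_chain_cat ct).
Qed.

(** Membership in T(n), apart from the normalization at oo. *)
Definition cover_drop n nu := forall x y, covers x y -> n <= nu x - nu y.

Lemma cover_drop_chain n nu x y t : cover_drop n nu ->
  has_saturated_chain x y t -> n * t%:Z <= nu x - nu y.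
Proof.
move=> nuP /saturated_chainP[s [<- + <-]].
elim: s x => [|z s IHs] x /=; first by rewrite mulr0 subrr.
case/andP=> /nuP xz /IHs zs; rewrite -add1n PoszD mulrDr mulr1.
by apply: le_trans (lerD xz zs) _; rewrite addrA subrK.
Qed.

Lemma cover_drop_qdist n nu x y : cover_drop n nu ->
  (x <= y)%O -> qdist n x y <= nu x - nu y.
Proof. by move=> nuP /(qdist_attained n)[t ct ->]; apply: cover_drop_chain ct. Qed.

Lemma qdist0 x y : (x <= y)%O -> qdist 0 x y = 0.
Proof. by move=> /(qdist_attained 0)[t _ ->]; rewrite mul0r. Qed.

Lemma covers_qdist n x y : covers x y -> n <= qdist n x y.
Proof. by move/covers_saturated_chain/(saturated_chain_qdist n); rewrite mulr1. Qed.

Lemma qdist_cover_drop n nu :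
  (forall x y, (x <= y)%O -> qdist n x y <= nu x - nu y) -> cover_drop n nu.
Proof.
move=> nuP x y xy; apply: le_trans (nuP _ _ (ltW (covers_lt xy))).
exact: covers_qdist.
Qed.

End QuasiDistance.

(** * Zigzags of tight ascents and descents *)

Section QSum.
Variables (disp : Order.disp_t) (H : finTBDistrLatticeType disp).
Variables (n : int) (w z : nat -> jirr_plus H).

Lemma qsum_self i : qsum n w z i i = qdist n (w i) (z i).
Proof. by rewrite /qsum big_nat1 big_geq // subr0. Qed.

Lemma qsumS i j : (i <= j)%N ->
  qsum n w z i j.+1 =
  qsum n w z i j + qdist n (w j.+1) (z j.+1) - qdist n (w j.+1) (z j).
Proof.
move=> le_ij; rewrite /qsum (big_nat_recr j.+1) /=; last exact: leqW.
by rewrite (big_nat_recr j.+1) //= opprD addrACA addrA addrAC.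
Qed.

(** The bracket is the value that [nu (z j)] takes when [nu] vanishes at [z k] and all the
    comparisons in the zigzag from [w j] to [z k] are tight. *)
Lemma qsum_split i j k : (i <= j <= k)%N ->
  qsum n w z i k = qsum n w z i j + (qsum n w z j k - qdist n (w j) (z j)).
Proof.
case/andP=> le_ij; elim: k => [|k IHk].
  by case: j le_ij => // _ _; rewrite qsum_self; lia.
rewrite leq_eqVlt => /predU1P[<-|]; first by rewrite qsum_self; lia.
rewrite ltnS => le_jk; rewrite !qsumS ?(leq_trans le_ij) // IHk //; lia.
Qed.

End QSum.

Section Zigzags.
Variables (disp : Order.disp_t) (H : finTBDistrLatticeType disp).
Local Notation P := (jirr H).
Local Notation Pplus := (jirr_plus H).
Local Notation oo := (infty H).
Variables (n : int) (nu : Pplus -> int).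
Hypothesis nuP : cover_drop n nu.
Implicit Types (x y z : Pplus) (s : seq (P * P)).

Lemma x0_min (x : P) : (x0 H <= x)%O.
Proof. exact: (@le0x _ H). Qed.

(** If [nu - mu] still drops by at least [n] along covers and [mu] is decreasing, then a
    step from [x] to [y] forces [mu x <= mu y]. *)
Definition forced_step x y := (y <= x)%O || covers x y && (nu x - nu y == n).

(** Equality [nu x - nu y = n * t] along one chain forces every cover of that chain to
    drop by exactly [n]; comparing with [qdist] avoids mentioning the chain. *)
Definition tight x y := (x <= y)%O && (nu x - nu y == qdist n x y).

Lemma tight_refl x : tight x x.
Proof. by rewrite /tight lexx subrr qdistxx eqxx. Qed.

Lemma tight_trans x y z : tight x y -> tight y z -> tight x z.
Proof.
case/andP=> xy /eqP exy /andP[yz /eqP eyz]; rewrite /tight (le_trans xy yz) /=.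
rewrite eq_le cover_drop_qdist ?(le_trans xy yz) // andbT.
by apply: le_trans (qdist_superadd n xy yz); rewrite -exy -eyz addrA subrK.
Qed.

Lemma tight_cover x y : covers x y -> nu x - nu y = n -> tight x y.
Proof.
move=> xy exy; have le_xy := ltW (covers_lt xy).
by rewrite /tight le_xy eq_le cover_drop_qdist // exy covers_qdist.
Qed.

Lemma tight_path_forced x (s : seq Pplus) : path (@covers disp Pplus) x s ->
  nu x - nu (last x s) = n * (size s)%:Z -> connect forced_step x (last x s).
Proof.
elim: s x => [|z s IHs] x /=; first by rewrite connect0.
case/andP=> xz sP; rewrite intS mulrDr mulr1 => exs.
have lexz : n <= nu x - nu z := nuP xz.
have lezs : n * (size s)%:Z <= nu z - nu (last z s).
  by apply: cover_drop_chain => //; apply/saturated_chainP; exists s.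
apply: connect_trans (IHs _ sP _); last by lia.
by apply: connect1; rewrite /forced_step xz; apply/orP; right; apply/eqP; lia.
Qed.

Lemma tight_forced x y : tight x y -> connect forced_step x y.
Proof.
case/andP=> /(qdist_attained n)[t ct ->] /eqP.
by case/saturated_chainP: ct => s [<- sP <-] /tight_path_forced; apply.
Qed.

(** A route from [x] to oo with [k] descents. Routes are counted by descents only, so
    that a chain of tight covers is a single ascent. *)
Fixpoint zigzag (k : nat) (x : P) : bool :=
  if k is k'.+1 then
    [exists y : P, [exists x' : P,
       [&& tight (Some x) (Some y), (x' <= y)%O & zigzag k' x']]]
  else tight (Some x) oo.

Lemma zigzagSP k (x : P) :
  reflect (exists y x' : P, [/\ tight (Some x) (Some y), (x' <= y)%O & zigzag k x'])
          (zigzag k.+1 x).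
Proof.
apply: (iffP existsP) => [[y /existsP[x' /and3P[*]]]|[y [x' [t le zk]]]].
  by exists y, x'.
by exists y; apply/existsP; exists x'; rewrite t le.
Qed.

Lemma tight_zigzag k (x x' : P) :
  tight (Some x) (Some x') -> zigzag k x' -> zigzag k x.
Proof.
move=> xx'; case: k => [|k] /=; first exact: tight_trans.
case/zigzagSP=> y [z [t zy zk]]; apply/zigzagSP; exists y, z; split=> //.
exact: tight_trans t.
Qed.

Lemma zigzag_down k (x x' : P) : (x' <= x)%O -> zigzag k x' -> zigzag k.+1 x.
Proof. by move=> le zk; apply/zigzagSP; exists x, x'; rewrite tight_refl. Qed.

Lemma forced_zigzag (x : P) :
  connect forced_step (Some x) oo -> exists k, zigzag k x.
Proof.
case/connectP => p; elim: p x => [|[x'|] p IHp] x //=.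
  case/andP=> /orP xx' pP pl; have [k zk] := IHp _ pP pl.
  case: xx' => [le_x'x|/andP[cxx' /eqP exx']].
    by exists k.+1; apply: zigzag_down zk.
  by exists k; apply: tight_zigzag zk; apply: tight_cover.
case/andP=> /orP[//|/andP[c /eqP e]] _ _; exists 0%N; exact: tight_cover.
Qed.

Definition zigzag_along s :=
  (forall i, (i <= size s)%N -> tight (xs s i) (ys s i)) /\
  (forall i, (i < size s)%N -> (xs s i.+1 <= ys s i)%O).

Lemma ys_lt s i : (i < size s)%N -> ys s i = Some (nth (x0 H) (unzip1 s) i).
Proof. by move=> lt_is; rewrite /ys (nth_map (x0 H)) // size_map. Qed.

Lemma ys_size s : ys s (size s) = oo.
Proof. by rewrite /ys nth_default // !size_map. Qed.

Local Notation x_ s i := (nth (x0 H) (x0 H :: unzip2 s) i).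

(** The induction is on the route from an arbitrary first element, in place of [x0]. *)
Lemma zigzag_along_exists k : zigzag k (x0 H) ->
  exists2 s, size s = k & zigzag_along s.
Proof.
rewrite /zigzag_along /xs; move: {1 3}(x0 H) => x.
elim: k x => [|k IHk] x.
  by move=> t; exists [::] => //; split=> // -[].
case/zigzagSP=> y [x' [t le /IHk[s ss [tP leP]]]].
exists ((y, x') :: s); first by rewrite /= ss.
by split=> -[|i] //=; [apply: tP | apply: leP].
Qed.

Section Along.
Variable s : seq (P * P).
Hypothesis sP : zigzag_along s.

Lemma zigzag_suffix k i : (i + k)%N = size s -> zigzag k (x_ s i).
Proof.
case: sP => tP leP; elim: k i => [|k IHk] i ei.
  by have := tP i; rewrite -ei addn0 leqnn -{2}(addn0 i) ei ys_size; apply.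
have lt_is : (i < size s)%N by rewrite -ei addnS ltnS leq_addr.
have := leP i lt_is; have := tP i (ltnW lt_is); rewrite ys_lt // => t le.
apply: tight_zigzag t (zigzag_down le _).
by apply: (IHk i.+1); rewrite addSnnS.
Qed.

Lemma zigzag_prefix k i : (i <= size s)%N -> zigzag k (x_ s i) ->
  zigzag (k + i) (x0 H).
Proof.
case: sP => tP leP; elim: i k => [|i IHi] k; first by rewrite addn0.
move=> lt_is zk; rewrite addnS -addSn; apply: IHi; first exact: ltnW.
have := leP i lt_is; have := tP i (ltnW lt_is); rewrite ys_lt // => t le.
by apply: tight_zigzag t _; apply: zigzag_down zk.
Qed.

Hypothesis shortest : forall k, zigzag k (x0 H) -> (size s <= k)%N.

Lemma no_shortcut k i : (i <= size s)%N -> (k + i < size s)%N ->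
  ~~ zigzag k (x_ s i).
Proof.
move=> le_is lt_ks; apply/negP => /(zigzag_prefix le_is)/shortest.
by rewrite leqNgt lt_ks.
Qed.

(** A tight ascent from [x_i] to [y_j] would replace everything in between and save
    [j - i] descents. *)
Lemma shortest_no_tight i j : (i < j <= size s)%N -> ~~ tight (xs s i) (ys s j).
Proof.
case/andP=> lt_ij le_js; apply/negP => t.
have /negP[] : ~~ zigzag (size s - j) (x_ s i) by apply: no_shortcut; lia.
move: le_js t; rewrite leq_eqVlt => /predU1P[->|lt_js].
  by rewrite ys_size subnn.
rewrite ys_lt // -subnSK // => t; apply: tight_zigzag t _.
have := proj2 sP j lt_js; rewrite ys_lt // => le.
by apply: zigzag_down le _; apply: (@zigzag_suffix _ j.+1); lia.
Qed.

(** A descent from [y_i] to [x_j] would replace everything in between and save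
    [j - i - 1] descents. *)
Lemma shortest_no_below i j : (i.+2 <= j <= size s)%N -> ~~ (xs s j <= ys s i)%O.
Proof.
case/andP=> lt_ij le_js; apply/negP => le.
have lt_is : (i < size s)%N by lia.
have /negP[] : ~~ zigzag (size s - j).+1 (x_ s i) by apply: no_shortcut; lia.
have := proj1 sP i (ltnW lt_is); move: le; rewrite ys_lt // => le t.
apply: tight_zigzag t (zigzag_down le _); apply: zigzag_suffix; lia.
Qed.

(** Each failure of condition N shortens the zigzag: it can start at an [x_i] equal to
    [x0], an equality [x_(i+1) = y_i] merges two ascents, and an equality [x_i = y_i]
    merges two descents. *)
Lemma shortest_condition_N : condition_N s.
Proof.
have [tP leP] := sP.
have x_neq0 i : (i < size s)%N -> x_ s i.+1 != x0 H.
  move=> lt_is; apply/eqP => e.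
  have /negP[] : ~~ zigzag (size s - i.+1) (x_ s 0) by apply: no_shortcut; lia.
  rewrite -[x_ s 0]e; apply: zigzag_suffix; lia.
split=> [p ps|i lt_is|i /andP[i_gt0 lt_is]|]; last exact: shortest_no_below.
- have [i lt_is <-] := nthP (x0 H, x0 H) ps.
  have := x_neq0 _ lt_is; rewrite /= (nth_map (x0 H, x0 H)) // => nx.
  split=> //; apply: contra nx => /eqP ey; rewrite eq_le x0_min andbT.
  by have := leP i lt_is; rewrite ys_lt // /xs /= !(nth_map (x0 H, x0 H)) // ey.
- rewrite lt_neqAle leP // andbT; apply/eqP => e.
  have /negP[] : ~~ tight (xs s i) (ys s i.+1) by apply: shortest_no_tight; lia.
  by apply: tight_trans (tP i _) _; [lia | rewrite -e; apply: tP].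
- have := tP i (ltnW lt_is); rewrite lt_neqAle => /andP[-> _]; rewrite andbT.
  apply/eqP => e; case: i i_gt0 lt_is e => // i _ lt_is e.
  have /negP[] : ~~ (xs s i.+2 <= ys s i)%O by apply: shortest_no_below; lia.
  by apply: le_trans (leP i.+1 lt_is) _; rewrite -e; apply: leP; lia.
Qed.

(** Ascents are tight and each descent changes [nu] by at least a quasi-distance. *)
Lemma zigzag_drop_qsum i j : (i <= j <= size s)%N ->
  nu (xs s i) - nu (ys s j) <= qsum n (xs s) (ys s) i j.
Proof.
have [tP leP] := sP; case/andP; elim: j => [|j IHj].
  by rewrite leqn0 => /eqP-> _; rewrite qsum_self; have /andP[_ /eqP->] := tP 0%N isT.
rewrite leq_eqVlt => /predU1P[->|].
  by move=> le_js; rewrite qsum_self; have /andP[_ /eqP->] := tP _ le_js.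
rewrite ltnS => le_ij lt_js; rewrite qsumS //.
have /andP[_ /eqP<-] := tP _ lt_js; have := IHj le_ij (ltnW lt_js).
by have := cover_drop_qdist nuP (leP _ lt_js); lia.
Qed.

(** If the inequality were not strict, the ascent from [x_i] to [y_j] would be tight. *)
Lemma shortest_q_reduced : q_reduced n s.
Proof.
move=> i j lt_ij le_xy; have /negP nt := shortest_no_tight lt_ij.
have le_q := cover_drop_qdist nuP le_xy.
rewrite lt_neqAle; apply/andP; split; last first.
  by apply: le_trans le_q _; apply: zigzag_drop_qsum; case/andP: lt_ij => /ltnW->.
apply/eqP => e; apply: nt; rewrite /tight le_xy eq_le le_q andbT e.
by apply: zigzag_drop_qsum; case/andP: lt_ij => /ltnW->.
Qed.

End Along.

Lemma forced_reduced_sequence :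
  nu oo = 0 -> connect forced_step (Some (x0 H)) oo ->
  nu (Some (x0 H)) != qdist n (Some (x0 H)) oo ->
  exists s, [/\ s != [::], condition_N s & q_reduced n s].
Proof.
move=> nu0 /forced_zigzag zk nq; case: (ex_minnP zk) => k kz kmin.
have [s ss sP] := zigzag_along_exists kz; rewrite -ss in kmin.
exists s; split; [|exact: shortest_condition_N|exact: shortest_q_reduced].
apply: contra nq => /eqP s0; have := proj1 sP 0%N.
by rewrite s0 /tight /= nu0 subr0 => /(_ isT).
Qed.

End Zigzags.

(** * The exponent of a reduced sequence *)

Section ForcedFromReduced.
Variables (disp : Order.disp_t) (H : finTBDistrLatticeType disp).
Local Notation P := (jirr H).
Local Notation Pplus := (jirr_plus H).
Local Notation oo := (infty H).
Variables (n : int) (s : seq (P * P)).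
Hypotheses (sN : condition_N s) (sq : q_reduced n s).

(** The value prescribed at [y_b]: it is the one for which all the pairs x_k, y_k and
    x_k, y_(k-1) with k > b are tight and the value at y_t = oo is 0. *)
Let val b := qsum n (xs s) (ys s) b (size s) - qdist n (xs s b) (ys s b).

(** The smallest function in T(n) that is at least [val b] at each [y_b]. The default
    value of the maximum is the term for y_t = oo. *)
Definition zigzag_potential (z : Pplus) : int :=
  \big[Num.max/qdist n z oo]_(b < size s | (z <= ys s b)%O)
     (qdist n z (ys s b) + val b).
Local Notation nu := zigzag_potential.

Lemma le_potential z b : (b <= size s)%N -> (z <= ys s b)%O ->
  qdist n z (ys s b) + val b <= nu z.
Proof.
rewrite leq_eqVlt => /predU1P[->|lt_bs] le_z.
  by rewrite /val qsum_self subrr addr0 ys_size bigmax_ge_id.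
exact: (@le_bigmax_cond _ _ _ _ (Ordinal lt_bs)).
Qed.

Lemma potential_le z a :
  (forall b, (b <= size s)%N -> (z <= ys s b)%O ->
     qdist n z (ys s b) + val b <= a) -> nu z <= a.
Proof.
move=> za; apply: bigmax_le => [|b le_z]; last exact: za (ltnW _) le_z.
have := za (size s) (leqnn _); rewrite /val qsum_self subrr addr0 ys_size.
by apply; case: (z).
Qed.

Lemma potential_cover_drop : cover_drop n nu.
Proof.
apply: qdist_cover_drop => x y le_xy.
suff : nu y <= nu x - qdist n x y by lia.
apply: potential_le => b le_bs le_yb.
have := le_potential le_bs (le_trans le_xy le_yb).
by have := qdist_superadd n le_xy le_yb; lia.
Qed.

Lemma potential_infty : nu oo = 0.
Proof.
by rewrite /zigzag_potential bigmax_eq_id ?qdistxx // => b; rewrite ys_lt.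
Qed.

(** Compatibility of the prescribed values. For a < b this is reducedness; for a = b and
    a = b + 1 it is an equality; the case a > b + 1 is excluded by condition N. *)
Lemma qdist_val_le a b : (a <= size s)%N -> (b <= size s)%N ->
  (xs s a <= ys s b)%O ->
  qdist n (xs s a) (ys s b) + val b <= qsum n (xs s) (ys s) a (size s).
Proof.
move=> le_as le_bs le_ab; have [_ _ _ sN'] := sN; rewrite /val.
case: (ltngtP a b) => [lt_ab|lt_ba|eab].
- by rewrite (@qsum_split _ _ _ _ _ a b) ?(ltnW lt_ab) // lerD2r ltW // sq // lt_ab.
- have ea : a = b.+1.
    apply/eqP; rewrite eqn_leq lt_ba andbT leqNgt; apply/negP => lt_b1a.
    by have := sN' b a; rewrite lt_b1a le_as le_ab => /(_ isT).
  rewrite ea in le_as *; rewrite (@qsum_split _ _ _ _ _ b b.+1) ?leqnSn //.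
  by rewrite qsumS // qsum_self; lia.
- by rewrite eab; lia.
Qed.

Lemma xs_le_ys a : (a <= size s)%N -> (xs s a <= ys s a)%O.
Proof.
rewrite leq_eqVlt => /predU1P[->|lt_as]; first by rewrite ys_size.
case: a lt_as => [|a] lt_as; last by have [_ _ /(_ a.+1 lt_as)/ltW] := sN.
by rewrite ys_lt //; apply: x0_min.
Qed.

(** The values that tightness prescribes at the [x_a] are attained. *)
Lemma potential_xs a : (a <= size s)%N -> nu (xs s a) = qsum n (xs s) (ys s) a (size s).
Proof.
move=> le_as; apply/eqP; rewrite eq_le; apply/andP; split.
  by apply: potential_le => b; apply: qdist_val_le.
by have := le_potential le_as (xs_le_ys le_as); rewrite /val; lia.
Qed.

Lemma potential_tight a : (a <= size s)%N -> tight n nu (xs s a) (ys s a).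
Proof.
move=> le_as; rewrite /tight xs_le_ys // eq_le.
rewrite (cover_drop_qdist potential_cover_drop) ?xs_le_ys // andbT.
by have := le_potential le_as (lexx _); rewrite potential_xs // qdistxx /val; lia.
Qed.

Lemma potential_forced : connect (forced_step n nu) (Some (x0 H)) oo.
Proof.
suff reach a : (a <= size s)%N -> connect (forced_step n nu) (Some (x0 H)) (ys s a).
  by rewrite -(ys_size s); apply: reach.
have up b : (b <= size s)%N -> connect (forced_step n nu) (xs s b) (ys s b).
  by move=> le_bs; apply/(tight_forced potential_cover_drop)/potential_tight.
elim: a => [|a IHa] le_as; first exact: (up 0%N).
apply: connect_trans (IHa (ltnW le_as)) (connect_trans _ (up _ le_as)).
have [_ /(_ _ le_as)/ltW le _ _] := sN.
by apply: connect1; rewrite /forced_step le.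
Qed.

Lemma potential_x0_neq : s != [::] -> qdist n (Some (x0 H)) oo != nu (Some (x0 H)).
Proof.
move=> s0; rewrite (potential_xs (leq0n _)) -{1}(ys_size s) lt_eqF //.
by apply: (sq (i := 0%N)); rewrite ?ys_size // leqnn lt0n size_eq0 s0.
Qed.

End ForcedFromReduced.

(** * Laurent monomials in the rational function field *)

Section Laurent.
Variables (K : fieldType) (disp : Order.disp_t) (H : finTBDistrLatticeType disp).
Local Notation P := (jirr H).
Local Notation F := (ratfun K H).
Local Notation E := {ffun P -> int}.
Local Notation T e := (@monom K disp H e).
Implicit Types (e : E) (A B : E -> Prop) (f g : F).

Lemma indet_neq0 (x : P) : indet K x != 0.
Proof.
rewrite /indet tofrac_eq0; apply/eqP => /(congr1 (mcoeff U_(enum_rank x))).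
by rewrite mcoeffX mcoeff0 eqxx => /eqP; rewrite oner_eq0.
Qed.

Lemma monomD e e' : T (e + e') = T e * T e'.
Proof.
rewrite /monom -big_split; apply: eq_bigr => x _.
by rewrite ffunE expfzDr ?indet_neq0.
Qed.

Lemma monom0 : T (0 : E) = 1.
Proof. by rewrite /monom big1 // => x _; rewrite ffunE expr0z. Qed.

Lemma monom_neq0 e : T e != 0.
Proof.
apply/eqP => /(congr1 (fun f => f * T (- e))).
by rewrite -monomD subrr monom0 mul0r => /eqP; rewrite oner_eq0.
Qed.

Lemma monom_ffun (nu : P -> int) : monom K nu = T [ffun x => nu x].
Proof. by apply: eq_bigr => x _; rewrite ffunE. Qed.

(** Exponent vector in the polynomial ring of a monomial without negative exponents. *)
Definition exponent e : 'X_{1..#|P|} := [multinom `|e (enum_val i)|%N | i < #|P|].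

Lemma monom_tofrac e : (forall x, 0 <= e x) ->
  T e = tofrac ('X_[exponent e] : {mpoly K[#|P|]}).
Proof.
move=> e0; rewrite mpolyXE_id rmorph_prod /= /monom.
rewrite (reindex_onto enum_val enum_rank) /=; last by move=> x _; rewrite enum_rankK.
apply: eq_big => [i|i _]; first by rewrite enum_valK eqxx.
by rewrite /indet enum_valK mnmE rmorphXn /= -{1}[e _]gez0_abs.
Qed.

Lemma exponent_inj e e' : (forall x, 0 <= e x) -> (forall x, 0 <= e' x) ->
  exponent e = exponent e' -> e = e'.
Proof.
move=> e0 e0' /mnmP ee; apply/ffunP => x; have := ee (enum_rank x).
by rewrite !mnmE enum_rankK => eq_abs; rewrite -[e x]gez0_abs // eq_abs gez0_abs.
Qed.

Lemma constD c d : const H (c + d) = const H c + const H d :> F.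
Proof. by rewrite /const mpolyCD rmorphD. Qed.
Lemma constM c d : const H (c * d) = const H c * const H d :> F.
Proof. by rewrite /const mpolyCM rmorphM. Qed.
Lemma const1 : const H 1 = 1 :> F.
Proof. by rewrite /const mpolyC1 rmorph1. Qed.
Lemma const0 : const H 0 = 0 :> F.
Proof. by rewrite /const mpolyC0 rmorph0. Qed.
Lemma constN c : const H (- c) = - const H c :> F.
Proof. by rewrite /const mpolyCN rmorphN. Qed.

Definition combination (c : E -> K) (l : seq E) : F :=
  \sum_(e <- l) const H (c e) * T e.

(** Multiplication by a monomial of large exponents turns the relation into one between
    distinct monomials of the polynomial ring. *)
Lemma monom_free c l : uniq l -> combination c l = 0 ->
  forall e, e \in l -> c e = 0.
Proof.
move=> ul sl0 e0 el.
pose M : E := [ffun x => \sum_(e <- l) `|e x|].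
have pos e : e \in l -> forall x, 0 <= (e + M) x.
  move=> ee x; rewrite !ffunE (big_rem e) //= addrA.
  by rewrite addr_ge0 ?sumr_ge0 // -lerBlDl sub0r -normrN ler_norm.
pose p : {mpoly K[#|P|]} := \sum_(e <- l) c e *: 'X_[exponent (e + M)].
have p0 : p = 0.
  apply/eqP; rewrite -tofrac_eq0 rmorph_sum /=; apply/eqP.
  transitivity (combination c l * T M); last by rewrite sl0 mul0r.
  rewrite mulr_suml; apply: eq_big_seq => e ee.
  by rewrite -mulrA -monomD monom_tofrac; [rewrite -mul_mpolyC rmorphM | exact: pos].
have := congr1 (mcoeff (exponent (e0 + M))) p0.
rewrite mcoeff0 raddf_sum /= (bigD1_seq e0) //= mcoeffZ mcoeffX eqxx mulr1.
rewrite big_seq_cond big1 ?addr0 // => e /andP[ee ne].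
rewrite mcoeffZ mcoeffX; case: eqP => [/exponent_inj eM|]; last by rewrite mulr0.
by case/eqP: ne; apply: (addIr M); apply: eM; apply: pos.
Qed.

(** The list [l] is the exact support of [c], which makes a Laurent polynomial determine
    [c] and makes its support available. *)
Definition supported (c : E -> K) (l : seq E) :=
  uniq l /\ forall e, (c e != 0) = (e \in l).

Lemma combination_filter c l :
  combination c [seq e <- l | c e != 0] = combination c l.
Proof.
rewrite /combination big_filter big_rmcond // => e /negPn/eqP->.
by rewrite const0 mul0r.
Qed.

Lemma combination_supported c l l' : supported c l -> uniq l' -> {subset l <= l'} ->
  combination c l' = combination c l.
Proof.
move=> [ul cl] ul' sll'; rewrite -combination_filter; apply: perm_big.
apply: uniq_perm; rewrite ?filter_uniq // => e; rewrite mem_filter cl.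
by case el: (e \in l) => //; rewrite sll'.
Qed.

Lemma combinationD c d l :
  combination (fun e => c e + d e) l = combination c l + combination d l.
Proof.
by rewrite /combination -big_split; apply: eq_bigr => e _; rewrite constD mulrDl.
Qed.

Lemma supported_unique c d l m : supported c l -> supported d m ->
  combination c l = combination d m -> c =1 d.
Proof.
move=> cl dm ecd e; have [[_ cE] [_ dE]] := (cl, dm).
pose r := undup (l ++ m); have ur : uniq r by apply: undup_uniq.
have lr : {subset l <= r} by move=> x xl; rewrite mem_undup mem_cat xl.
have mr : {subset m <= r} by move=> x xl; rewrite mem_undup mem_cat xl orbT.
have cd0 : combination (fun x => c x - d x) r = 0.
  rewrite combinationD (combination_supported cl) // ecd.
  rewrite -(combination_supported dm ur) // -combinationD.
  by rewrite /combination big1 // => x _; rewrite subrr const0 mul0r.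
case er: (e \in r).
  by apply/eqP; rewrite -subr_eq0 (monom_free ur cd0 er).
move/negbT: er; rewrite mem_undup mem_cat negb_or -cE -dE !negbK.
by case/andP=> /eqP-> /eqP->.
Qed.

Definition monomial_span A : F -> Prop :=
  lin_span (@scalars K disp H) (fun f => exists2 e, A e & f = T e).

Lemma monomial_span_supported A f : monomial_span A f ->
  exists c l, [/\ supported c l, forall e, e \in l -> A e & f = combination c l].
Proof.
elim=> [|_ _ {}f [a ->] [e Ae ->] _ [c [l [cl lA ->]]]].
  exists (fun=> 0), [::]; split=> //; last by rewrite /combination big_nil.
  by split=> // e; rewrite eqxx.
pose d x := (if x == e then a else 0) + c x.
pose m := undup (e :: l); have um : uniq m by apply: undup_uniq.
have lm : {subset l <= m} by move=> x xl; rewrite mem_undup inE xl orbT.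
have cE := proj2 cl.
exists d, [seq x <- m | d x != 0]; split.
- split=> [|x]; first exact: filter_uniq.
  rewrite mem_filter mem_undup inE /d.
  case: (x =P e) => [->|_] //=; first by rewrite andbT.
  by rewrite add0r cE andbb.
- by move=> x; rewrite mem_filter mem_undup inE => /andP[_ /predU1P[->|/lA]].
- rewrite combination_filter combinationD (combination_supported cl) //; congr (_ + _).
  rewrite /combination (bigD1_seq e) ?mem_undup ?mem_head //= eqxx.
  by rewrite big1 ?addr0 // => x /negPf->; rewrite const0 mul0r.
Qed.

(** This is what makes a span of monomials graded by exponents: all terms of an element
    of the span lie in the span. *)
Lemma monomial_span_support A c l : supported c l ->
  monomial_span A (combination c l) -> forall e, e \in l -> A e.
Proof.
move=> cl /monomial_span_supported[d [m [dm mA ecd]]] e.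
by rewrite -(proj2 cl) (supported_unique cl dm ecd) (proj2 dm); apply: mA.
Qed.

End Laurent.

Section LinSpan.
Variables (K : fieldType) (disp : Order.disp_t) (H : finTBDistrLatticeType disp).
Local Notation F := (ratfun K H).
Implicit Types (R S : F -> Prop) (f g : F).

Lemma lin_span_sub R S S' : (forall f, S f -> S' f) ->
  forall f, lin_span R S f -> lin_span R S' f.
Proof.
by move=> SS' f; elim=> [|a s g Ra /SS' S's _ IH]; [left | right].
Qed.

Lemma lin_spanD R S f g : lin_span R S f -> lin_span R S g -> lin_span R S (f + g).
Proof.
move=> Sf Sg; elim: Sf => [|a s h Ra Ss _ IH]; first by rewrite add0r.
by rewrite -addrA; right.
Qed.

Lemma lin_span_gen R S a s : R a -> S s -> lin_span R S (a * s).
Proof. by move=> Ra Ss; rewrite -[_ * _]addr0; right => //; left. Qed.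

Lemma lin_spanZ R S a f : (forall b c, R b -> R c -> R (b * c)) ->
  R a -> lin_span R S f -> lin_span R S (a * f).
Proof.
move=> RM Ra; elim=> [|b s h Rb Ss _ IH]; first by rewrite mulr0; left.
by rewrite mulrDr mulrA; right=> //; apply: RM.
Qed.

Lemma lin_span_trans R S S' : (forall b c, R b -> R c -> R (b * c)) ->
  (forall s, S s -> lin_span R S' s) ->
  forall f, lin_span R S f -> lin_span R S' f.
Proof.
move=> RM SS' f; elim=> [|a s g Ra /SS' S's _ IH]; first by left.
by apply: lin_spanD => //; apply: lin_spanZ.
Qed.

Lemma scalarsM (a b : F) : scalars a -> scalars b -> scalars (a * b).
Proof. by case=> [c ->] [d ->]; exists (c * d); rewrite constM. Qed.

Lemma scalars1 : scalars (1 : F).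
Proof. by exists 1; rewrite const1. Qed.

End LinSpan.

Section MonomialSpan.
Variables (K : fieldType) (disp : Order.disp_t) (H : finTBDistrLatticeType disp).
Local Notation P := (jirr H).
Local Notation F := (ratfun K H).
Local Notation E := {ffun P -> int}.
Local Notation T e := (@monom K disp H e).
Local Notation mspan := (@monomial_span K disp H).
Implicit Types (e : E) (A B : E -> Prop) (f g : F).

Lemma monomial_span_monom A e : A e -> mspan A (T e).
Proof.
by move=> Ae; rewrite -[T e]mul1r; apply: lin_span_gen; [apply: scalars1 | exists e].
Qed.

Lemma monomial_span_sub A B : (forall e, A e -> B e) ->
  forall f, mspan A f -> mspan B f.
Proof.
by move=> AB; apply: lin_span_sub => f [e Ae ->]; exists e => //; apply: AB.
Qed.

Lemma monomial_spanM A B C : (forall e e', A e -> B e' -> C (e + e')) ->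
  forall f g, mspan A f -> mspan B g -> mspan C (f * g).
Proof.
move=> ABC f g Af Bg; elim: Af => [|a _ h Sa [e Ae ->] _ IH].
  by rewrite mul0r; left.
rewrite mulrDl; apply: lin_spanD => //.
rewrite -mulrA; apply: lin_spanZ => //; first exact: scalarsM.
elim: Bg => [|b _ k Sb [e' Be' ->] _ IHg]; first by rewrite mulr0; left.
rewrite mulrDr mulrCA -monomD; right=> //; exists (e + e') => //.
exact: ABC.
Qed.

Lemma monomial_spanB A f g : mspan A f -> mspan A g -> mspan A (f - g).
Proof.
move=> Af Ag; apply: lin_spanD => //; rewrite -mulN1r; apply: lin_spanZ => //.
  exact: scalarsM.
by exists (-1); rewrite constN const1.
Qed.

Lemma monomial_spanI A B f : mspan A f -> mspan B f ->
  mspan (fun e => A e /\ B e) f.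
Proof.
case/monomial_span_supported=> c [l [cl lA ->]] Bf.
have lB := monomial_span_support cl Bf.
rewrite /combination big_seq; elim/big_ind: _ => [|g h|e el]; first by left.
  exact: lin_spanD.
by apply: lin_span_gen; [exists (c e) | exists e => //; split; [apply: lA | apply: lB]].
Qed.

Lemma monomial_span_empty A f : mspan A f -> (forall e, ~ A e) -> f = 0.
Proof. by move=> Af A0; elim: Af => // a s g _ [e /A0]. Qed.

Lemma monom_in_span A e : mspan A (T e) -> A e.
Proof.
move=> Ae; have /monomial_spanI/(_ Ae)/monomial_span_supported : mspan (eq e) (T e).
  exact: monomial_span_monom.
case=> c [[|e' l] [_ lA eT]]; last by have [->] := lA e' (mem_head _ _).
by have := monom_neq0 K e; rewrite eT /combination big_nil eqxx.
Qed.

End MonomialSpan.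

(** * The Hibi ring, omega and omega^(-1) as spans of monomials *)

Section Exponents.
Variables (disp : Order.disp_t) (H : finTBDistrLatticeType disp).
Local Notation P := (jirr H).
Local Notation Pplus := (jirr_plus H).
Local Notation E := {ffun P -> int}.
Implicit Types (e m : E) (n : int).

Definition extend e (x : Pplus) : int := if x is Some y then e y else 0.

Lemma extendD e m x : extend (e + m) x = extend e x + extend m x.
Proof. by case: x => [x|] /=; rewrite ?ffunE ?addr0. Qed.

Lemma extendB e m x : extend (e - m) x = extend e x - extend m x.
Proof. by case: x => [x|] /=; rewrite ?ffunE ?subr0. Qed.

Definition drop_exponent n e : Prop := cover_drop n (extend e).

Lemma drop_exponentD n k e m :
  drop_exponent n e -> drop_exponent k m -> drop_exponent (n + k) (e + m).
Proof.
move=> eP mP x y xy; rewrite !extendD; have := eP x y xy; have := mP x y xy; lia.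
Qed.

Lemma hibi_exponent_le e (x y : Pplus) : drop_exponent 0 e -> (x <= y)%O ->
  extend e y <= extend e x.
Proof. by move=> eP xy; have := cover_drop_qdist eP xy; rewrite qdist0 // subr_ge0. Qed.

Lemma hibi_exponent_ge0 e (x : P) : drop_exponent 0 e -> 0 <= e x.
Proof. by move=> /(@hibi_exponent_le e (Some x) None); apply. Qed.

Lemma hibi_exponent_eq0 e : drop_exponent 0 e -> e (x0 H) <= 0 -> e = 0.
Proof.
move=> eP e0; apply/ffunP => x; rewrite ffunE; apply/eqP.
rewrite eq_le hibi_exponent_ge0 // andbT (le_trans _ e0) //.
exact: (@hibi_exponent_le e (Some (x0 H)) (Some x) eP (x0_min x)).
Qed.

Lemma hibi_exponent0 : drop_exponent 0 0.
Proof. by case=> [x|] [y|] _ /=; rewrite ?ffunE. Qed.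

Definition indicator (I : {set P}) : E := [ffun x => (x \in I)%:Z].

Lemma indicator_exponent (I : {set P}) : down_closed I -> drop_exponent 0 (indicator I).
Proof.
move=> Id [x|] [y|] /covers_lt xy //=; rewrite ?ffunE ?subr0 //.
case yI: (y \in I); last by rewrite subr0.
by rewrite (Id _ _ yI (ltW xy)).
Qed.

Definition least_exponent n : E := [ffun x => qdist n (Some x) (infty H)].

Lemma extend_least n x : extend (least_exponent n) x = qdist n x (infty H).
Proof. by case: x => [x|] /=; rewrite ?ffunE ?qdistxx. Qed.

Lemma least_exponentP n : drop_exponent n (least_exponent n).
Proof.
apply: qdist_cover_drop => x y xy; rewrite !extend_least lerBrDr.
by apply: qdist_superadd; case: y xy.
Qed.

(** The smallest degree of an element of T(n); [least_exponent] attains it. *)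
Lemma drop_exponent_ge n e : drop_exponent n e ->
  qdist n (Some (x0 H)) (infty H) <= e (x0 H).
Proof.
move=> eP; have := cover_drop_qdist (y := infty H) (x := Some (x0 H)) eP isT.
by rewrite subr0.
Qed.

(** Tightness at x <. y is the additional constraint nu(y) - nu(x) >= -1. The exponent is
    the maximal weight of a walk to oo in the Hasse diagram with all weights 1 and an
    additional edge from y to x of weight -1. There is no cycle of positive weight since
    the only chain from x to y has length 1. *)
Lemma cover_tight_exponent (x y : Pplus) : covers x y ->
  exists2 e : E, drop_exponent 1 e & extend e x - extend e y = 1.
Proof.
move=> xy; have lt_xy := covers_lt xy; pose oo := infty H.
have le_oo (z : Pplus) : (z <= oo)%O by case: z.
pose nu z := if (z <= y)%O then Num.max (qdist 1 z oo) (qdist 1 z y - 1 + qdist 1 x oo)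
             else qdist 1 z oo.
have qxy : qdist 1 x y = 1.
  apply/eqP; rewrite eq_le covers_qdist // andbT.
  have [[|[|t]] c ->] := qdist_attained 1 (ltW lt_xy); rewrite ?mul1r //.
  have /saturated_chainP[[|u [|v s]] [//= _ /and3P[xu uv sP] vy]] := c.
  case/andP: xy => _ /existsP[]; exists u; rewrite (covers_lt xu).
  apply: lt_le_trans (covers_lt uv) _; rewrite -vy.
  by apply: (saturated_chain_le (t := size s)); apply/saturated_chainP; exists s.
have qy : qdist 1 y oo + 1 <= qdist 1 x oo.
  by have := qdist_superadd 1 (ltW lt_xy) (le_oo y); rewrite qxy addrC.
have nuP : cover_drop 1 nu.
  apply: qdist_cover_drop => z w zw; rewrite /nu.
  have q1 := qdist_superadd 1 zw (le_oo w).
  case: ifP => [zy|/negbT nzy]; case: ifP => [wy|/negbT nwy].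
  - by have q2 := qdist_superadd 1 zw wy; lia.
  - lia.
  - by case/negP: nzy; apply: le_trans wy.
  - lia.
have nux : nu x = qdist 1 x oo by rewrite /nu ltW // qxy; lia.
have nuy : nu y = qdist 1 x oo - 1 by rewrite /nu lexx qdistxx; lia.
have nu0 : nu oo = 0.
  rewrite /nu qdistxx; case: ifP => // le_ooy; have yoo : y = oo by case: (y) le_ooy.
  have -> : qdist 1 x oo = 1 by move: qxy; rewrite yoo.
  by rewrite yoo qdistxx subrK maxxx.
have extE z : extend [ffun u => nu (Some u)] z = nu z.
  by case: z => [z|] /=; rewrite ?ffunE // -nu0.
exists [ffun u => nu (Some u)]; last by rewrite !extE nux nuy; lia.
by move=> z w zw; rewrite !extE; apply: nuP.
Qed.

End Exponents.

Section Realization.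
Variables (K : fieldType) (disp : Order.disp_t) (H : finTBDistrLatticeType disp).
Local Notation P := (jirr H).
Local Notation Pplus := (jirr_plus H).
Local Notation F := (ratfun K H).
Local Notation E := {ffun P -> int}.
Local Notation T e := (@monom K disp H e).
Local Notation mspan := (@monomial_span K disp H).
Implicit Types (e m : E) (A B : E -> Prop) (f g : F).

Lemma monom_indicator (I : {set P}) : T (indicator I) = \prod_(x in I) indet K x.
Proof.
rewrite /monom [RHS]big_mkcond; apply: eq_bigr => x _.
by rewrite ffunE; case: (x \in I); rewrite ?expr1z ?expr0z.
Qed.

(** Subtract the indicator of the set where [e] is positive, and use induction on the
    degree. *)
Lemma hibi_monom e : drop_exponent 0 e -> hibi (T e).
Proof.
have [k] := ubnP `|e (x0 H)|%N; elim: k e => // k IHk e; rewrite ltnS => le_k eP.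
have ge0 := hibi_exponent_ge0 _ eP.
have [e0|e_gt0] := leP (e (x0 H)) 0.
  by rewrite (hibi_exponent_eq0 eP e0) monom0 -(const1 K H); apply: hibi_const.
pose I := [set x | 1 <= e x].
have Id : down_closed I.
  move=> x y; rewrite !inE => /le_trans xI le_yx; apply: xI.
  exact: (@hibi_exponent_le _ _ e (Some y) (Some x) eP le_yx).
rewrite -(subrK (indicator I) e) monomD; apply: hibi_mul; last first.
  rewrite monom_indicator; apply: hibi_gen => //.
  by apply/set0Pn; exists (x0 H); rewrite inE.
apply: IHk.
  by rewrite !ffunE inE; move: e_gt0 le_k (ge0 (x0 H)); case: leP => //=; lia.
move=> x y xy; rewrite !extendB.
have := hibi_exponent_le eP (ltW (covers_lt xy)); have := covers_lt xy.
case: x y xy => [x|] [y|] xy // lt_xy /=; rewrite !ffunE !inE; last lia.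
by have := ge0 x; have := ge0 y; lia.
Qed.

Lemma hibiE f : hibi f <-> mspan (drop_exponent 0) f.
Proof.
split.
  elim=> [c|I I0 Id|g h _ Cg _ Ch|g h _ Cg _ Ch].
  - rewrite -[const H c]mulr1 -(monom0 K H); apply: lin_span_gen; first by exists c.
    by exists 0 => //; apply: hibi_exponent0.
  - by rewrite -monom_indicator; apply/monomial_span_monom/indicator_exponent.
  - exact: lin_spanD.
  - by apply: monomial_spanM Cg Ch => e m /drop_exponentD; apply.
elim=> [|_ _ g [c ->] [e eP ->] _ IH].
  by rewrite -(const0 K H); apply: hibi_const.
by apply: hibi_add => //; apply: hibi_mul (hibi_const _ _) (hibi_monom eP).
Qed.

Lemma homogeneousE d f : homogeneous d f <-> mspan (fun e => e (x0 H) = d) f.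
Proof.
split; apply: lin_span_sub => g.
  case=> nu [nud ->]; exists [ffun x => nu x]; last exact: monom_ffun.
  by rewrite ffunE.
by case=> e ed ->; exists e.
Qed.

Lemma omegaE f : omega f <-> mspan (drop_exponent 1) f.
Proof.
split; apply: lin_span_sub => g.
  case=> nu [nu0 nuP ->]; exists [ffun x => nu (Some x)]; last exact: monom_ffun.
  move=> x y /nuP; case: x y => [x|] [y|] /=; rewrite ?ffunE /infty ?nu0 //.
by case=> e eP ->; exists (extend e).
Qed.

(** If f is in omega^(-1), then f T^m is in R for each exponent m of omega, so e + m is in
    T(0) for each exponent e of f. When m drops by exactly 1 along x <. y, this gives
    e(x) - e(y) >= -1. *)
Lemma omega_invE f : omega_inv f <-> mspan (drop_exponent (-1)) f.
Proof.
pose h := least_exponent H 1; have hP : drop_exponent 1 h := least_exponentP 1.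
have hT : T h \is a GRing.unit by rewrite unitfE monom_neq0.
split=> [[_ fP]|fP]; last first.
  have fO g : omega g -> hibi (f * g).
    move=> /omegaE gP; apply/hibiE; apply: monomial_spanM fP gP.
    exact: drop_exponentD.
  split=> //; exists (f * T h), (T h); split; last by rewrite mulrK.
  - by apply/fO/omegaE/monomial_span_monom.
  - by apply: hibi_monom => x y /hP; apply: le_trans.
  - exact: monom_neq0.
have fM m : drop_exponent 1 m -> mspan (drop_exponent 0) (f * T m).
  by move=> mP; apply/hibiE/fP/omegaE/monomial_span_monom.
have /monomial_span_supported[c [l [[ul cl] _ ef]]] : mspan (fun=> True) f.
  have -> : f = f * T h * T (- h) by rewrite -mulrA -monomD subrr monom0 mulr1.
  apply: (@monomial_spanM _ _ _ _ (fun e => e = - h)) (fM h hP) _ => //.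
  exact: monomial_span_monom.
rewrite ef; suff lP e : e \in l -> drop_exponent (-1) e.
  rewrite /combination big_seq; elim/big_ind: _ => [|g k|e /lP eP]; first by left.
    exact: lin_spanD.
  by apply: lin_span_gen; [exists (c e) | exists e].
move=> el x y xy; have [m mP mxy] := cover_tight_exponent xy.
pose d e := c (e - m); pose l' := [seq e + m | e <- l].
have dl' : supported d l'.
  split; first by rewrite map_inj_uniq //; apply: addIr.
  by move=> k; rewrite /d cl /l' -{2}(subrK m k) (mem_map (addIr m)).
have fm : f * T m = combination d l'.
  rewrite ef /combination mulr_suml big_map; apply: eq_bigr => k _.
  by rewrite /d addrK monomD mulrA.
have := fM m mP; rewrite fm => /(monomial_span_support dl')/(_ (e + m)).
move=> /(_ (map_f _ el))/(_ x y xy); rewrite !extendD; lia.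
Qed.

End Realization.

(** * Degrees of minimal generators *)

Section Generators.
Variables (K : fieldType) (disp : Order.disp_t) (H : finTBDistrLatticeType disp).
Local Notation P := (jirr H).
Local Notation F := (ratfun K H).
Local Notation E := {ffun P -> int}.
Local Notation T e := (@monom K disp H e).
Local Notation mspan := (@monomial_span K disp H).
Local Notation deg e := (fun_of_fin e (x0 H)).
Variables (A : E -> Prop) (M : F -> Prop) (d0 : int).
Hypothesis hibiA : forall m e, drop_exponent 0 m -> A e -> A (m + e).
Hypothesis A_ge : forall e, A e -> d0 <= deg e.
Hypothesis ME : forall f, M f <-> mspan A f.
Implicit Types (e m : E) (f g : F) (S : F -> Prop).

Lemma degD e m : deg (e + m) = deg e + deg m :> int.
Proof. by rewrite ffunE. Qed.

Lemma degB e m : deg (e - m) = deg e - deg m :> int.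
Proof. by rewrite !ffunE. Qed.

(** Nonzero elements of T(0) have positive degree, so these are the exponents of the
    monomials outside R_+ M. *)
Definition minimal_exponent e : Prop :=
  A e /\ forall m, drop_exponent 0 m -> A (e - m) -> m = 0.

Lemma above_minimal e : A e ->
  exists m e', [/\ drop_exponent 0 m, minimal_exponent e' & e = m + e'].
Proof.
have [k] := ubnP `|deg e - d0|%N; elim: k e => // k IHk e; rewrite ltnS => le_k Ae.
have [min_e|] := classic (minimal_exponent e).
  by exists 0, e; rewrite add0r; split=> //; apply: hibi_exponent0.
move/not_and_or; case=> [nA|]; first by case: nA.
case/not_all_ex_not=> m nm; have [mP nAm] := imply_to_and _ _ nm.
have [Aem m0] := imply_to_and _ _ nAm.
have m_gt0 : 0 < deg m.
  by rewrite ltNge; apply/negP => /(hibi_exponent_eq0 mP).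
have [|m' [e' [m'P min_e' eem]]] := IHk (e - m) _ Aem.
  have := A_ge Aem; have := A_ge Ae; rewrite degB; lia.
exists (m + m'), e'; split=> //; last by rewrite -addrA -eem addrC subrK.
by move=> x y xy; rewrite -(addr0 0); apply: drop_exponentD xy.
Qed.

Lemma hibiM (a b : F) : hibi a -> hibi b -> hibi (a * b).
Proof. exact: hibi_mul. Qed.

Lemma hibi1 : hibi (1 : F).
Proof. by rewrite -(const1 K H); apply: hibi_const. Qed.

Lemma hibi_scale a f : hibi a -> M f -> M (a * f).
Proof.
by move=> /hibiE aP /ME fP; apply/ME; apply: monomial_spanM aP fP => m e; apply: hibiA.
Qed.

Lemma lin_span_hibi_sub S f :
  (forall g, S g -> M g) -> lin_span (@hibi K disp H) S f -> M f.
Proof.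
move=> SM; elim=> [|a s g aP /SM sM _ /ME gP]; first by apply/ME; left.
by apply/ME/lin_spanD => //; apply/ME/hibi_scale.
Qed.

Lemma generates_sub S g : generates S M -> S g -> M g.
Proof.
by move=> SM Sg; apply/SM; rewrite -[g]mul1r; apply: lin_span_gen => //; apply: hibi1.
Qed.

Lemma minimal_generate f : M f ->
  lin_span (@hibi K disp H) (fun g => exists2 e, minimal_exponent e & g = T e) f.
Proof.
move=> /ME; elim=> [|_ _ g [c ->] [e Ae ->] _ IH]; first by left.
have [m [e' [mP e'min ->]]] := above_minimal Ae.
rewrite monomD mulrA; right=> //; last by exists e'.
by apply: hibi_mul; [apply: hibi_const | apply: hibi_monom].
Qed.

(** If a minimal [T e] is an R-combination of minimal monomials, it is a term of some
    a T^e' with a in R, so e = m + e' with m in T(0); minimality of e gives e' = e. *)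
Lemma minimal_system : minimal_homogeneous_system M
  (fun g : F => exists2 e, minimal_exponent e & g = T e).
Proof.
split.
- move=> _ [e _ ->]; exists (deg e); apply/homogeneousE; exact: monomial_span_monom.
- move=> f; split; first exact: minimal_generate.
  by apply: lin_span_hibi_sub => g [e [Ae _] ->]; apply/ME/monomial_span_monom.
move=> S S_min S_gen _ [e e_min ->]; have [Ae eP] := e_min.
pose B k := exists m e',
  [/\ drop_exponent 0 m, S (T e'), minimal_exponent e' & k = m + e'].
suff : mspan B (T e).
  case/monom_in_span=> m [e' [mP Se' [Ae' _] eme']].
  have m0 : m = 0 by apply: eP => //; rewrite eme' addrC addKr.
  by rewrite eme' m0 add0r.
have /S_gen : M (T e) by apply/ME/monomial_span_monom.
elim=> [|a s g /hibiE aP Ss _ IH]; first by left.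
apply: lin_spanD => //; have [e' e'min es] := S_min _ Ss; rewrite es in Ss *.
apply: monomial_spanM aP (@monomial_span_monom _ _ _ (eq e') e' erefl).
by move=> m _ mP <-; exists m, e'.
Qed.

Lemma generator_neq0 S f : minimal_homogeneous_system M S -> S f -> f != 0.
Proof.
case=> _ S_gen S_min Sf; apply/eqP => f0.
suff gen : generates (fun g => S g /\ g <> 0) M.
  by have [_] := S_min _ (fun g => @proj1 _ _) gen f Sf.
move=> g; rewrite (S_gen g); split; last by apply: lin_span_sub => h [].
elim=> [|a s h aP Ss _ IH]; first by left.
by have [->|/eqP s0] := eqVneq s 0; [rewrite mulr0 add0r | right].
Qed.

Lemma span_disjoint (A1 A2 : E -> Prop) f :
  mspan A1 f -> mspan A2 f -> (forall e, A1 e -> ~ A2 e) -> f = 0.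
Proof.
move=> f1 f2 dis; apply: (monomial_span_empty (monomial_spanI f1 f2)).
by move=> e [/dis].
Qed.

(** Let d be a lower bound of the degrees of M, and let f be an element of S of higher degree. The
    part h of degree d of a combination of S involves only scalar multiples of the
    elements of S of degree d, so it does not involve f. *)
Lemma degree_part S d f d_f : generates S M ->
  (forall e, A e -> d <= deg e) -> (forall g, S g -> exists k, homogeneous k g) ->
  d < d_f -> homogeneous d_f f -> f != 0 ->
  forall g, lin_span (@hibi K disp H) S g ->
  exists h k, [/\ lin_span (@hibi K disp H) (fun s => S s /\ s <> f) h,
    mspan (fun e => deg e = d) h, mspan (fun e => d < deg e) k & g = h + k].
Proof.
move=> S_gen A_d S_hom lt_d fP f0 g.
elim=> [|a s g' /hibiE aP Ss _ [h [k [hS hd kd ->]]]].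
  by exists 0, 0; rewrite addr0; split=> //; left.
have /ME sA := generates_sub S_gen Ss.
have [ds /homogeneousE sds] := S_hom s Ss.
have a_ge : mspan (fun e => 0 <= deg e) a.
  by apply: monomial_span_sub aP => m /hibi_exponent_ge0; apply.
have [le_ds|lt_ds] := leP ds d; last first.
  exists h, (a * s + k); split=> //; last by rewrite addrCA.
  apply: lin_spanD => //; apply: monomial_spanM a_ge sds => m e.
  by rewrite degD => m0 ->; lia.
have sd : mspan (fun e => deg e = d) s.
  by apply: monomial_span_sub (monomial_spanI sA sds) => e [/A_d]; lia.
have [c [b [-> bP]]] : exists c b, a = const H c + b /\ mspan (fun e => 0 < deg e) b.
  elim: aP {a_ge} => [|_ _ b [c ->] [m mP ->] _ [c' [b' [-> b'P]]]].
    by exists 0, 0; rewrite const0 addr0; split=> //; left.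
  have [m0|m_gt0] := leP (deg m) 0.
    exists (c + c'), b'; split=> //.
    by rewrite (hibi_exponent_eq0 mP m0) monom0 mulr1 constD addrA.
  exists c', (const H c * T m + b'); split; first by rewrite addrCA.
  by right=> //; [exists c | exists m].
exists (const H c * s + h), (b * s + k); split.
- right=> //; first exact: hibi_const.
  split=> // sf; case/eqP: f0; rewrite sf in sd.
  move/homogeneousE: fP => fP; apply: (span_disjoint fP sd) => e -> ed; lia.
- apply: lin_spanD => //; apply: lin_spanZ => //; [exact: scalarsM | by exists c].
- apply: lin_spanD => //; apply: monomial_spanM bP sd => m e.
  by rewrite degD => m0 ->; lia.
- by rewrite mulrDl addrACA.
Qed.

(** Graded Nakayama lemma for a module generated in degree d: an element of S in another
    degree is redundant, since M is generated by its part of degree d, which is spanned by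
    the rest of S. *)
Lemma generator_degree d S f d_f :
  (forall e, minimal_exponent e -> deg e = d) ->
  minimal_homogeneous_system M S -> S f -> homogeneous d_f f -> d_f = d.
Proof.
move=> min_d SP Sf fP; have f0 := generator_neq0 SP Sf.
have [S_hom S_gen S_min] := SP.
have A_d e : A e -> d <= deg e.
  case/above_minimal=> m [e' [mP /min_d e'd ->]]; rewrite degD e'd.
  by have := hibi_exponent_ge0 (x0 H) mP; lia.
have [lt_d|lt_d|//] := ltgtP d_f d.
  have /ME fA := generates_sub S_gen Sf; move/homogeneousE: fP => fP.
  by case/eqP: f0; apply: (span_disjoint fA fP) => e /A_d; lia.
suff gen : generates (fun s => S s /\ s <> f) M.
  by have [] := S_min _ (fun g => @proj1 _ _) gen f Sf.
move=> g; split; last by move=> gS; apply/S_gen; apply: lin_span_sub gS => s [].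
move=> /minimal_generate; apply: lin_span_trans hibiM _ _ => _ [e e_min ->].
have [Ae _] := e_min; have /S_gen : M (T e) by apply/ME/monomial_span_monom.
case/(degree_part S_gen A_d S_hom lt_d fP f0) => h [k [hS hd kd eT]].
suff k0 : k = 0 by rewrite eT k0 addr0.
apply: (span_disjoint _ kd (A1 := fun e => deg e = d)); last by move=> m ->; lia.
have -> : k = T e - h by rewrite eT addrC addKr.
by apply: monomial_spanB => //; apply: monomial_span_monom; apply: min_d.
Qed.

(** The minimal monomials are themselves a minimal homogeneous system, and if they all
    have the same degree, every other minimal homogeneous system has that degree too by
    the graded Nakayama lemma. *)
Lemma same_degree_minimal : generated_in_same_degree M <->
  forall e e', minimal_exponent e -> minimal_exponent e' -> deg e = deg e'.
Proof.
split=> [same e e' e_min e'_min|same f g d e [S [SP Sf]] [S' [SP' Sg]] fd ge].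
  have gen (k : E) : minimal_exponent k -> minimal_homogeneous_generator M (T k).
    by move=> k_min; eexists; split; [apply: minimal_system | exists k].
  have hom (k : E) : homogeneous (deg k) (T k).
    by apply/homogeneousE; apply: monomial_span_monom.
  exact: same (gen _ e_min) (gen _ e'_min) (hom e) (hom e').
have [_ S_gen _] := SP; have /ME := generates_sub S_gen Sf.
case/monomial_span_supported=> c [[|e1 l] [_ lA ef]].
  by have := generator_neq0 SP Sf; rewrite ef /combination big_nil eqxx.
have [_ [e2 [_ e2_min _]]] := above_minimal (lA _ (mem_head _ _)).
have min_d e3 : minimal_exponent e3 -> deg e3 = deg e2 by move=> /same; apply.
by rewrite (generator_degree min_d SP Sf fd) (generator_degree min_d SP' Sg ge).
Qed.

End Generators.

(** * The criterion *)

Section Criterion.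
Variables (K : fieldType) (disp : Order.disp_t) (H : finTBDistrLatticeType disp).
Local Notation P := (jirr H).
Local Notation E := {ffun P -> int}.
Local Notation oo := (infty H).
Variable n : int.
Implicit Types (e m : E).

(** If oo is not reached, the indicator of the set of reached elements can be subtracted.
    If oo is reached, a subtracted [m] satisfies [m x0 <= m oo = 0], since it does not
    decrease along forced steps. *)
Lemma minimal_exponent_forced e : drop_exponent n e ->
  minimal_exponent (drop_exponent n) e <->
  connect (forced_step n (extend e)) (Some (x0 H)) oo.
Proof.
move=> eP; split=> [[_ e_min]|reach]; last first.
  split=> // m mP emP; apply: (hibi_exponent_eq0 mP).
  suff up x y : connect (forced_step n (extend e)) x y -> extend m x <= extend m y.
    exact: up reach.
  case/connectP=> p; elim: p x => [|z p IHp] x /=; first by move=> _ ->.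
  case/andP=> xz zp /(IHp _ zp); apply: le_trans.
  case/orP: xz => [zx|/andP[xz /eqP exz]]; first exact: hibi_exponent_le.
  by have := emP x z xz; rewrite !extendB; lia.
apply/negPn/negP => nreach.
pose I := [set x : P | connect (forced_step n (extend e)) (Some (x0 H)) (Some x)].
pose reached (x : jirr_plus H) := connect (forced_step n (extend e)) (Some (x0 H)) x.
have down (x y : jirr_plus H) : reached x -> (y <= x)%O -> reached y.
  by move=> rx yx; apply: connect_trans rx (connect1 _); rewrite /forced_step yx.
have extI x : extend (indicator I) x = (reached x)%:Z.
  case: x => [x|] /=; rewrite ?ffunE ?inE //.
  by move/negPf: nreach; rewrite /reached => ->.
have Id : down_closed I.
  by move=> x y; rewrite !inE => rx yx; exact: (down (Some x) (Some y) rx yx).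
have /ffunP/(_ (x0 H)) : indicator I = 0; last by rewrite !ffunE inE connect0.
apply: e_min (indicator_exponent Id) _ => x y xy; rewrite !extendB !extI.
have := eP x y xy; case rx: (reached x); last first.
  suff -> : reached y = false by lia.
  by apply: contraFF rx => ry; apply: down ry (ltW (covers_lt xy)).
have [exy|ne] := eqVneq (extend e x - extend e y) n; last by case: (reached y); lia.
suff -> : reached y by lia.
by apply: connect_trans rx (connect1 _); rewrite /forced_step xy exy eqxx orbT.
Qed.

Lemma eq_forced_step (nu mu : jirr_plus H -> int) :
  nu =1 mu -> connect (forced_step n nu) =2 connect (forced_step n mu).
Proof. by move=> e; apply: eq_connect => x y; rewrite /forced_step !e. Qed.

Lemma reduced_sequence_iff :
  (exists s : seq (P * P), [/\ s != [::], condition_N s & q_reduced n s]) <->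
  exists2 e, minimal_exponent (drop_exponent n) e
           & e (x0 H) != qdist n (Some (x0 H)) oo.
Proof.
split=> [[s [s0 sN sq]]|[e e_min ne]]; last first.
  have [eP _] := e_min; apply: (forced_reduced_sequence eP) => //.
  exact/(minimal_exponent_forced eP).
pose nu := zigzag_potential n s.
pose e : E := [ffun x => nu (Some x)].
have enu : extend e =1 nu.
  by case=> [x|] /=; [rewrite ffunE | exact/esym/potential_infty].
have eP : drop_exponent n e.
  by move=> x y xy; rewrite !enu; apply: potential_cover_drop.
exists e; last by rewrite ffunE eq_sym; apply: potential_x0_neq.
by apply/(minimal_exponent_forced eP); rewrite (eq_forced_step enu) potential_forced.
Qed.

Lemma least_minimal : minimal_exponent (drop_exponent n) (least_exponent H n).
Proof.
split=> [|m mP lmP]; first exact: least_exponentP.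
apply: (hibi_exponent_eq0 mP); have := drop_exponent_ge lmP.
by rewrite degB ffunE lerBrDr gerDl.
Qed.

Lemma same_degree_iff (M : ratfun K H -> Prop) :
  (forall f, M f <-> monomial_span (drop_exponent n) f) ->
  generated_in_same_degree M <->
  forall s : seq (P * P), condition_N s /\ q_reduced n s <-> s = [::].
Proof.
move=> ME.
have hibiA (m e : E) :
    drop_exponent 0 m -> drop_exponent n e -> drop_exponent n (m + e).
  by move=> mP eP x y xy; rewrite -(add0r n); apply: drop_exponentD xy.
have A_ge := @drop_exponent_ge _ H n.
rewrite (same_degree_minimal hibiA A_ge ME); split=> [same s|only_nil].
  split=> [[sN sq]|->]; last first.
    split=> [|i j /andP[/leq_trans le /le] //].
    by split=> [p|i|i|i j] //; [rewrite ltn0 andbF | move=> /andP[/leq_trans le /le]].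
  apply/eqP/negPn/negP => s0; have [] := proj1 reduced_sequence_iff.
    by exists s.
  by move=> e /same/(_ least_minimal); rewrite ffunE => -> /eqP.
suff deg_min e : minimal_exponent (drop_exponent n) e ->
    e (x0 H) = qdist n (Some (x0 H)) oo.
  by move=> e e' /deg_min-> /deg_min->.
move=> e_min; apply/eqP/negPn/negP => ne.
have [|s [s0 sN sq]] := proj2 reduced_sequence_iff; first by exists e.
by case/eqP: s0; apply/only_nil.
Qed.

End Criterion.

Theorem theorem3p12 (K : fieldType) (disp : Order.disp_t)
    (H : finTBDistrLatticeType disp) :
  (level K H <->
     forall s : seq (jirr H * jirr H),
       condition_N s /\ q_reduced 1 s <-> s = [::])
  /\
  (anticanonical_level K H <->
     forall s : seq (jirr H * jirr H),
       condition_N s /\ q_reduced (-1) s <-> s = [::]).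
Proof.
split; apply: same_degree_iff => f; [exact: omegaE | exact: omega_invE].
Qed.
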